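(* Let $k$ be an algebraically closed field and let $A=\oplus_{n\ge0}A_n$ be a standard graded algebra over $k$ with $d=\dim A\ge1$. Let $x_1,\ldots,x_m$ be linear forms generating the vector space $A_1$, let $u=(u_{ij}\mid 1\le i\le d,\,1\le j\le m)$ be indeterminates, and let $Q_u$ be the ideal of $A[u]$ generated by the $d$ generic linear forms $z_i=u_{i1}x_1+\cdots+u_{im}x_m$, $i=1,\ldots,d$. Put $A(u)=A\otimes_kk(u)$. Then $$\operatorname{core}(A)\subseteq Q_uA(u)\cap A.$$
   Context: A reduction of $A$ is a graded ideal $Q$ of $A$ generated by linear forms (elements of $A_1$) such that $Q_n=A_n$ for all large $n$. $\operatorname{core}(A)$ is the intersection of all reductions of $A$. Here $k(u)$ is the field of fractions of the polynomial ring $k[u]$. *)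

(* Defs.v *)
From HB Require Import structures.
From mathcomp Require Import all_boot all_order all_algebra.
From mathcomp Require Import mathcomp_extra boolp classical_sets.
From mathcomp Require Import mpoly.

Set Implicit Arguments.
Unset Strict Implicit.
Unset Printing Implicit Defensive.

Import GRing.Theory.
Local Open Scope classical_set_scope.
Local Open Scope ring_scope.
Local Open Scope quotient_scope.

(* Unlike idealr_closed, this allows the unit ideal. The ideal generated by a  *)
(* set S is the library's [smallest ideal S].                                  *)
Definition ideal {R : comPzRingType} (I : set R) : Prop :=
  [/\ I 0, forall a b, I a -> I b -> I (a + b) & forall c a, I a -> I (c * a)].

Definition prime_ideal (R : comNzRingType) (P : set R) : Prop :=
  idealr_closed (mem P) /\ prime_idealr_closed (mem P).

Definition prime_chain (R : comNzRingType) (n : nat) (P : nat -> set R) : Prop :=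
  (forall i, (i <= n)%N -> prime_ideal (P i)) /\
  (forall i, (i < n)%N -> P i `<` P i.+1).

Definition krull_dim_eq (R : comNzRingType) (d : nat) : Prop :=
  (exists P : nat -> set R, prime_chain d P) /\
  (forall n (P : nat -> set R), prime_chain n P -> (n <= d)%N).

Section Graded.
Variables (k : fieldType) (A : comAlgType k) (A_ : nat -> set A).

Record graded_algebra : Prop := {
  graded_submod : forall n, GRing.submod_closed (mem (A_ n));
  graded_mul : forall i j a b, A_ i a -> A_ j b -> A_ (i + j)%N (a * b);
  graded_sum : forall a, exists N (c : nat -> A),
    (forall n, A_ n (c n)) /\ a = \sum_(n < N) c n;
  graded_direct : forall N (c : nat -> A), (forall n, A_ n (c n)) ->
    \sum_(n < N) c n = 0 -> forall n, (n < N)%N -> c n = 0 }.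

Record standard_graded : Prop := {
  standard_graded_algebra : graded_algebra;
  standard_degree0 : A_ 0%N = range (fun c : k => c%:A);
  standard_degree1 : exists r (y : 'I_r -> A),
    A_ 1%N = range (fun c : 'I_r -> k => \sum_j c j *: y j);
  standard_generated :
    smallest (fun S : set A => GRing.subalg_closed (mem S)) (A_ 1%N) = setT }.

Definition graded_ideal (Q : set A) : Prop :=
  ideal Q /\ (forall N (c : nat -> A), (forall n, A_ n (c n)) ->
    Q (\sum_(n < N) c n) -> forall n, (n < N)%N -> Q (c n)).

Definition reduction (Q : set A) : Prop :=
  [/\ graded_ideal Q,
      exists2 L : set A, L `<=` A_ 1%N & Q = smallest ideal L
    & exists n0, forall n, (n0 <= n)%N -> Q `&` A_ n = A_ n].

Definition core : set A := \bigcap_(Q in reduction) Q.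

End Graded.

Section Tensor.
Variables (k : comNzRingType) (A B : comAlgType k).

(* A sequence [:: (a1, b1); ...; (an, bn)] stands for the formal sum           *)
(* a1 (x) b1 + ... + an (x) bn. Quotienting the free commutative monoid rather *)
(* than the free module makes the relation 0 (x) b = 0 necessary.              *)
Inductive tensor_rel : seq (A * B) -> seq (A * B) -> Prop :=
| tensor_perm s t : perm_eq s t -> tensor_rel s t
| tensor_sym s t : tensor_rel s t -> tensor_rel t s
| tensor_trans s t u : tensor_rel s t -> tensor_rel t u -> tensor_rel s u
| tensor_cat s s' t t' :
    tensor_rel s s' -> tensor_rel t t' -> tensor_rel (s ++ t) (s' ++ t')
| tensor_zero b : tensor_rel [:: (0, b)] [::]
| tensor_addl a a' b : tensor_rel [:: (a + a', b)] [:: (a, b); (a', b)]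
| tensor_addr a b b' : tensor_rel [:: (a, b + b')] [:: (a, b); (a, b')]
| tensor_scale (c : k) a b : tensor_rel [:: (c *: a, b)] [:: (a, c *: b)].

Lemma tensor_refl s : tensor_rel s s.
Proof. exact: tensor_perm. Qed.

Definition tensor_eq (s t : seq (A * B)) : bool := `[< tensor_rel s t >].

Lemma tensor_eq_equiv : equiv_class_of tensor_eq.
Proof.
split.
- by move=> s; apply/asboolP/tensor_refl.
- by move=> s t; apply/asboolP/asboolP; apply: tensor_sym.
- by move=> s t u /asboolP h1 /asboolP h2; apply/asboolP/(tensor_trans h1 h2).
Qed.

Canonical tensor_eq_equivRel := EquivRelPack tensor_eq_equiv.

Definition tensor := {eq_quot tensor_eq}.
HB.instance Definition _ : EqQuotient _ tensor_eq tensor := EqQuotient.on tensor.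
HB.instance Definition _ := Choice.on tensor.

Lemma tensor_pi s t : tensor_rel s t -> \pi_tensor s = \pi_tensor t.
Proof. by move=> h; apply/eqmodP/asboolP. Qed.

Lemma tensor_repr s : tensor_rel (repr (\pi_tensor s)) s.
Proof. by apply/asboolP/(@eqquotP _ tensor_eq tensor); rewrite reprK. Qed.

Lemma tensorW (P : tensor -> Prop) :
  (forall s, P (\pi_tensor s)) -> forall u, P u.
Proof. by move=> h u; rewrite -[u]reprK. Qed.

Definition seq_opp (s : seq (A * B)) := [seq (- x.1, x.2) | x <- s].
Definition pair_mul (x y : A * B) : A * B := (x.1 * y.1, x.2 * y.2).
Definition seq_mul (s t : seq (A * B)) := [seq pair_mul x y | x <- s, y <- t].

Lemma seq_opp_rel s t : tensor_rel s t -> tensor_rel (seq_opp s) (seq_opp t).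
Proof.
elim=> {s t}.
- by move=> s t h; apply/tensor_perm/perm_map.
- by move=> s t _; apply: tensor_sym.
- by move=> s t u _ h1 _; apply: tensor_trans.
- by move=> s s' t t' _ h1 _ h2; rewrite /seq_opp !map_cat; apply: tensor_cat.
- by move=> b; rewrite /= oppr0; apply: tensor_zero.
- by move=> a a' b; rewrite /= opprD; apply: tensor_addl.
- by move=> a b b'; apply: tensor_addr.
- by move=> c a b; rewrite /= -scalerN; apply: tensor_scale.
Qed.

Lemma seq_mul_perm s s' t t' :
  perm_eq s s' -> perm_eq t t' -> perm_eq (seq_mul s t) (seq_mul s' t').
Proof. by move=> h1 h2; apply: perm_allpairs. Qed.

Lemma pair_mulC x y : pair_mul x y = pair_mul y x.
Proof. by rewrite /pair_mul mulrC [x.2 * _]mulrC. Qed.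

Lemma seq_mulC s t : tensor_rel (seq_mul s t) (seq_mul t s).
Proof.
apply: tensor_perm; elim: s => [|x s ih].
  by rewrite /seq_mul allpairs0l allpairs0r.
rewrite perm_sym /seq_mul perm_allpairs_consr allpairs_cons (eq_map (pair_mulC^~ x)) perm_cat2l.
by rewrite perm_sym.
Qed.

Lemma seq_mul1_rel (x : A * B) s t :
  tensor_rel s t -> tensor_rel (seq_mul s [:: x]) (seq_mul t [:: x]).
Proof.
elim=> {s t}.
- by move=> s t h; apply/tensor_perm/seq_mul_perm.
- by move=> s t _; apply: tensor_sym.
- by move=> s t u _ h1 _; apply: tensor_trans.
- by move=> s s' t t' _ h1 _ h2; rewrite /seq_mul !allpairs_cat; apply: tensor_cat.
- by move=> b; rewrite /seq_mul /pair_mul /= mul0r; apply: tensor_zero.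
- by move=> a a' b; rewrite /seq_mul /pair_mul /= mulrDl; apply: tensor_addl.
- by move=> a b b'; rewrite /seq_mul /pair_mul /= mulrDl; apply: tensor_addr.
- by move=> c a b; rewrite /seq_mul /pair_mul /= -!scalerAl; apply: tensor_scale.
Qed.

Lemma seq_mul_consr s x t :
  tensor_rel (seq_mul s (x :: t)) (seq_mul s [:: x] ++ seq_mul s t).
Proof.
by apply: tensor_perm; rewrite /seq_mul perm_allpairs_consr allpairs1r.
Qed.

Lemma seq_mul_rel s s' t t' :
  tensor_rel s s' -> tensor_rel t t' -> tensor_rel (seq_mul s t) (seq_mul s' t').
Proof.
have mull u v w : tensor_rel u v -> tensor_rel (seq_mul u w) (seq_mul v w).
  move=> h; elim: w => [|x w ih].
    by apply: tensor_perm; rewrite /seq_mul !allpairs0r.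
  apply: (tensor_trans (seq_mul_consr _ _ _)).
  apply/(tensor_trans _ (tensor_sym (seq_mul_consr _ _ _))).
  by apply: tensor_cat ih; apply: seq_mul1_rel.
move=> h1 h2; apply: (tensor_trans (mull _ _ t h1)).
apply: (tensor_trans (seq_mulC _ _)); apply: (tensor_trans (mull _ _ s' h2)).
exact: seq_mulC.
Qed.

Definition tensor_pure (a : A) (b : B) : tensor := \pi_tensor [:: (a, b)].

Definition tensor_add (u v : tensor) : tensor := \pi_tensor (repr u ++ repr v).
Definition tensor_opp (u : tensor) : tensor := \pi_tensor (seq_opp (repr u)).
Definition tensor_mul (u v : tensor) : tensor := \pi_tensor (seq_mul (repr u) (repr v)).

Lemma tensor_addE s t :
  tensor_add (\pi_tensor s) (\pi_tensor t) = \pi_tensor (s ++ t).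
Proof. by apply: tensor_pi; apply: tensor_cat; apply: tensor_repr. Qed.

Lemma tensor_oppE s : tensor_opp (\pi_tensor s) = \pi_tensor (seq_opp s).
Proof. by apply/tensor_pi/seq_opp_rel/tensor_repr. Qed.

Lemma tensor_mulE s t :
  tensor_mul (\pi_tensor s) (\pi_tensor t) = \pi_tensor (seq_mul s t).
Proof. by apply: tensor_pi; apply: seq_mul_rel; apply: tensor_repr. Qed.

Fact tensor_addA : associative tensor_add.
Proof. by elim/tensorW=> s; elim/tensorW=> t; elim/tensorW=> u; rewrite !tensor_addE catA. Qed.

Fact tensor_addC : commutative tensor_add.
Proof.
by elim/tensorW=> s; elim/tensorW=> t; rewrite !tensor_addE; apply/tensor_pi/tensor_perm;
  rewrite perm_catC.
Qed.

Fact tensor_add0 : left_id (\pi_tensor [::]) tensor_add.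
Proof. by elim/tensorW=> ?; rewrite tensor_addE. Qed.

Fact tensor_addN : left_inverse (\pi_tensor [::]) tensor_opp tensor_add.
Proof.
elim/tensorW=> s; rewrite tensor_oppE tensor_addE; apply: tensor_pi.
elim: s => [|[a b] s ih]; first exact: tensor_refl.
apply: (@tensor_trans _ ([:: (- a, b); (a, b)] ++ (seq_opp s ++ s))).
  apply: tensor_perm; rewrite /= perm_cons.
  exact: permEl (perm_catCA (seq_opp s) [:: (a, b)] s).
rewrite -[X in tensor_rel _ X]cat0s; apply: tensor_cat ih.
apply: (tensor_trans (tensor_sym (tensor_addl _ _ _))).
by rewrite addNr; apply: tensor_zero.
Qed.

HB.instance Definition _ := GRing.isZmodule.Build tensor
  tensor_addA tensor_addC tensor_add0 tensor_addN.

Fact tensor_mulA : associative tensor_mul.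
Proof.
elim/tensorW=> s; elim/tensorW=> t; elim/tensorW=> u.
rewrite !tensor_mulE; congr (\pi_tensor _).
elim: s => [//|x s ih].
have mulcons y (v w : seq (A * B)) :
    seq_mul (y :: v) w = map (pair_mul y) w ++ seq_mul v w by [].
have mulcat v w r : seq_mul (v ++ w) r = seq_mul v r ++ seq_mul w r.
  exact: allpairs_cat.
rewrite !mulcons mulcat -ih; congr (_ ++ _).
elim: t {ih} => [//|y t ih].
rewrite /= !mulcons map_cat ih -map_comp; congr (_ ++ _); apply: eq_map => z.
by rewrite /pair_mul /= !mulrA.
Qed.

Fact tensor_mulC : commutative tensor_mul.
Proof.
by elim/tensorW=> s; elim/tensorW=> t; rewrite !tensor_mulE; apply/tensor_pi/seq_mulC.
Qed.

Fact tensor_mul1 : left_id (tensor_pure 1 1) tensor_mul.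
Proof.
elim/tensorW=> s; rewrite tensor_mulE /seq_mul allpairs1l; congr (\pi_tensor _).
by rewrite -[RHS]map_id; apply: eq_map => -[a b]; rewrite /pair_mul !mul1r.
Qed.

Fact tensor_mulDl : left_distributive tensor_mul +%R.
Proof.
elim/tensorW=> s; elim/tensorW=> t; elim/tensorW=> u.
by rewrite /GRing.add /= !(tensor_addE, tensor_mulE) /seq_mul allpairs_cat.
Qed.

HB.instance Definition _ := GRing.Zmodule_isComPzRing.Build tensor
  tensor_mulA tensor_mulC tensor_mul1 tensor_mulDl.

End Tensor.

(* The field k(u) of rational functions in n indeterminates, as a k-algebra.   *)
Section RationalFunctions.
Variables (k : fieldType) (n : nat).

Definition ratfun := {fraction {mpoly k[n]}}.
HB.instance Definition _ := GRing.Field.on ratfun.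

Definition ratfun_poly (p : {mpoly k[n]}) : ratfun := tofrac p.

Definition ratfun_scale (c : k) (f : ratfun) : ratfun := ratfun_poly c%:MP * f.

Fact ratfun_scaleA a b f :
  ratfun_scale a (ratfun_scale b f) = ratfun_scale (a * b) f.
Proof. by rewrite /ratfun_scale /ratfun_poly mpolyCM tofracM mulrA. Qed.

Fact ratfun_scale1 : left_id 1 ratfun_scale.
Proof. by move=> f; rewrite /ratfun_scale /ratfun_poly mpolyC1 tofrac1 mul1r. Qed.

Fact ratfun_scaleDr : right_distributive ratfun_scale +%R.
Proof. by move=> c f g; rewrite /ratfun_scale mulrDr. Qed.

Fact ratfun_scaleDl f : {morph ratfun_scale^~ f : a b / a + b}.
Proof.
by move=> a b; rewrite /ratfun_scale /ratfun_poly mpolyCD tofracD mulrDl.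
Qed.

HB.instance Definition _ := GRing.Zmodule_isLmodule.Build k ratfun
  ratfun_scaleA ratfun_scale1 ratfun_scaleDr ratfun_scaleDl.

Fact ratfun_scaleAl (c : k) (f g : ratfun) : c *: (f * g) = c *: f * g.
Proof. exact: mulrA. Qed.

HB.instance Definition _ := GRing.Lmodule_isLalgebra.Build k ratfun ratfun_scaleAl.
HB.instance Definition _ := GRing.Lalgebra_isComAlgebra.Build k ratfun.

End RationalFunctions.

Section GenericForms.
Variables (k : fieldType) (A : comAlgType k) (d m : nat).

(* u_ij is the indeterminate of index [mxvec_index i j].                       *)
Definition generic_form (x : 'I_m -> A) (i : 'I_d) : {mpoly A[d * m]} :=
  \sum_(j < m) (x j)%:MP * 'X_(mxvec_index i j).

Definition generic_ideal (x : 'I_m -> A) : set {mpoly A[d * m]} :=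
  smallest ideal (range (generic_form x)).

Definition generic_algebra := tensor A (ratfun k (d * m)).
HB.instance Definition _ := GRing.ComPzRing.on generic_algebra.

Definition to_generic (a : A) : generic_algebra := tensor_pure a 1.

(* The canonical homomorphism A[u] -> A(u), a u^e |-> a (x) u^e; it is not an  *)
(* instance of mmap because A(u) is not declared to be nontrivial.             *)
Definition mpoly_to_generic (p : {mpoly A[d * m]}) : generic_algebra :=
  \sum_(e <- msupp p) tensor_pure p@_e (ratfun_poly 'X_[e]).

Definition extended_generic_ideal (x : 'I_m -> A) : set generic_algebra :=
  smallest ideal (mpoly_to_generic @` generic_ideal x).

End GenericForms.

(* Main.v *)
Require Import Defs.
From HB Require Import structures.
From mathcomp Require Import all_boot all_order all_algebra.
From mathcomp Require Import mathcomp_extra boolp classical_sets.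
From mathcomp Require Import mpoly.

Set Implicit Arguments.
Unset Strict Implicit.
Unset Printing Implicit Defensive.

Import GRing.Theory.
Local Open Scope classical_set_scope.
Local Open Scope ring_scope.

(** Write [z_i(v)] for the linear form obtained from the generic form [z_i] by
    giving the indeterminates the values [v] in [k], and [Q_v] for the ideal of
    these [d] forms.

    For almost all [v] the ideal [Q_v] is a reduction, that is, there is a
    nonzero polynomial [F] such that [Q_v] is a reduction whenever [F(v) != 0]
    ([generic_reductions]). An element [a] of the core, which may be taken
    homogeneous of degree [n + 1] as the core is graded and vanishes in degree 0,
    therefore lies in [Q_v] for all these [v].
    In bases of [A_n] and [A_(n+1)], the membership of [a] in [Q_v] is a linear
    system over [k] whose matrix is the value at [v] of a matrix [M] over
    [k[u]], and the membership of [a (x) 1] in [Q_u A(u)] follows from the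
    solvability of the system of matrix [M] over [k(u)]. If the latter had no
    solution, a vector [w] over [k(u)] would annihilate the rows of [M] but not
    the coordinates of [a]; after clearing denominators, [w] is polynomial and
    its pairing with [a] is a nonzero polynomial [P] ([generic_solution_or_witness]).
    As [k] is infinite, some [v] satisfies [F(v) P(v) != 0]
    ([mpoly_nonvanishing]); there [w(v)] shows that [a] is not in [Q_v], a
    contradiction.

    It remains to find [F]. If [Q_v] contains [A_(n+1)] for one [v], then it does
    so for all [v] outside the zeros of a determinant ([full_degree_open]), and a
    standard graded algebra then has its higher components in [Q_v] too. So one
    reduction generated by [d] linear forms suffices ([exists_linear_parameters]).
    The algebra is Noetherian ([standard_graded_acc]), so each ideal contains a
    finite product of primes containing it ([acc_contains_prime_product]). Choose
    [y_1, ..., y_d] in [A_1] one after the other, [y_(i+1)] outside those of the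
    finitely many primes attached in this way to [(y_1, ..., y_i)] that do not
    contain [A_1]; this is possible as [k] is infinite. If a prime [P_d] containing
    all [y_i] but not [A_1] were contained in the irrelevant ideal, descending
    through these finite sets of primes would give a chain of length [d] ending
    at [P_d], and the irrelevant ideal would prolong it to length [d + 1],
    against [dim A = d]. Hence every prime attached to [(y_1, ..., y_d)] contains
    [A_1] or an element with nonzero constant term, and by homogeneity the latter
    primes can be ignored ([product_sub_saturation]): a power of the
    irrelevant ideal lies in [(y_1, ..., y_d)]. *)

(** * The ascending chain condition for finitely generated algebras *)

Section HilbertBasis.
Variable R : comNzRingType.
Implicit Types (S I : set R) (x : R).

Definition subring S : Prop :=
  [/\ S 1, forall a b, S a -> S b -> S (a - b)
    & forall a b, S a -> S b -> S (a * b)].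

(** Ideals of a subring are taken as subsets of the ambient ring, so that the
    adjunction of successive generators needs no new ring structures. *)
Definition ideal_in S I : Prop :=
  [/\ I `<=` S, I 0, forall a b, I a -> I b -> I (a + b)
    & forall c a, S c -> I a -> I (c * a)].

Definition acc S : Prop :=
  forall I : nat -> set R, (forall n, ideal_in S (I n)) ->
  (forall n, I n `<=` I n.+1) -> exists N, forall n, (N <= n)%N -> I n `<=` I N.

Lemma subring0 S : subring S -> S 0.
Proof. by case=> S1 SB _; rewrite -(subrr 1); apply: SB. Qed.

Lemma subringN S a : subring S -> S a -> S (- a).
Proof. by move=> hS Sa; rewrite -sub0r; case: (hS) => _ SB _; apply: (SB) Sa; apply: subring0. Qed.

Lemma subringD S a b : subring S -> S a -> S b -> S (a + b).
Proof.
move=> hS Sa Sb; rewrite -[b]opprK; case: (hS) => _ SB _.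
by apply: SB => //; apply: subringN.
Qed.

Lemma chain_le (I : nat -> set R) : (forall n, I n `<=` I n.+1) ->
  forall i j, (i <= j)%N -> I i `<=` I j.
Proof.
move=> sI i j /subnK <-; elim: (j - i)%N => [//|n ih].
by rewrite addSn; apply: (subset_trans ih).
Qed.

Definition poly_below S x i : set R :=
  [set a | exists c : nat -> R, (forall j, S (c j)) /\ a = \sum_(j < i) c j * x ^+ j].

Definition adjoin S x : set R := [set a | exists i, poly_below S x i a].

Section Adjoin.
Variables (S : set R) (x : R).
Hypothesis subringS : subring S.
Local Notation T := (poly_below S x).

Lemma poly_belowS i a :
  T i.+1 a <-> exists c q, [/\ S c, T i q & a = c * x ^+ i + q].
Proof.
split=> [[c [Sc ->]]|[c [_ [Sc [e [Se ->]] ->]]]].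
  by exists (c i), (\sum_(j < i) c j * x ^+ j); split=> //;
    [exists c | rewrite big_ord_recr addrC].
exists (fun j => if j == i then c else e j); split=> [j|]; first by case: eqP.
rewrite big_ord_recr /= eqxx addrC; congr (_ + _).
by apply: eq_bigr => j _; rewrite ltn_eqF.
Qed.

Lemma poly_below0 i : T i 0.
Proof.
exists (fun=> 0); split=> [_|]; first exact: subring0.
by rewrite big1 // => j _; rewrite mul0r.
Qed.

Lemma poly_belowB i a b : T i a -> T i b -> T i (a - b).
Proof.
move=> [c [Sc ->]] [e [Se ->]]; exists (fun j => c j - e j); split=> [j|].
  by case: subringS => _ SB _; apply: SB.
by rewrite -sumrB; apply: eq_bigr => j _; rewrite mulrBl.
Qed.

Lemma poly_belowD i a b : T i a -> T i b -> T i (a + b).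
Proof.
move=> Ta Tb; rewrite -[b]opprK; apply: poly_belowB Ta _.
by rewrite -sub0r; apply: poly_belowB Tb; apply: poly_below0.
Qed.

Lemma poly_belowZ i c a : S c -> T i a -> T i (c * a).
Proof.
move=> Sc [e [Se ->]]; exists (fun j => c * e j); split=> [j|].
  by case: subringS => _ _ SM; apply: SM.
by rewrite mulr_sumr; apply: eq_bigr => j _; rewrite mulrA.
Qed.

Lemma poly_below_mulx i a : T i a -> T i.+1 (a * x).
Proof.
move=> [e [Se ->]]; exists (fun j => if j is j'.+1 then e j' else 0).
split=> [[|j]|] //; first exact: subring0.
rewrite big_ord_recl /= mul0r add0r mulr_suml.
by apply: eq_bigr => j _; rewrite -mulrA -exprSr.
Qed.

Lemma poly_below_le i j : (i <= j)%N -> T i `<=` T j.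
Proof.
apply: chain_le => n a Ta; apply/poly_belowS; exists 0, a.
by split=> //; [exact: subring0 | rewrite mul0r add0r].
Qed.

Lemma poly_below_mulXn i n a : T i a -> exists j, T j (a * x ^+ n).
Proof.
move=> Ta; exists (n + i)%N; elim: n => [|n ih]; first by rewrite mulr1.
by rewrite exprSr mulrA addSn; apply: poly_below_mulx.
Qed.

Lemma sub_adjoin : S `<=` adjoin S x.
Proof.
move=> a Sa; exists 1%N; exists (fun=> a); split=> //.
by rewrite big_ord1 mulr1.
Qed.

Lemma adjoin_gen : adjoin S x x.
Proof.
exists 2%N; rewrite -{2}[x]mul1r; apply: poly_below_mulx.
exists (fun=> 1); split=> [_|]; first by case: subringS.
by rewrite big_ord1 mulr1.
Qed.

Lemma adjoin_subring : subring (adjoin S x).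
Proof.
have adjB a b : adjoin S x a -> adjoin S x b -> adjoin S x (a - b).
  move=> [i Ta] [j Tb]; exists (maxn i j); apply: poly_belowB.
    exact: poly_below_le (leq_maxl i j) _ Ta.
  exact: poly_below_le (leq_maxr i j) _ Tb.
have adj0 : adjoin S x 0 by exists 0%N; apply: poly_below0.
have adjD a b : adjoin S x a -> adjoin S x b -> adjoin S x (a + b).
  by move=> Sa Sb; rewrite -[b]opprK; apply/adjB => //; rewrite -sub0r; apply: adjB.
split=> //; first by apply: sub_adjoin; case: subringS.
move=> a b Sa [j [c [Sc ->]]]; rewrite mulr_sumr.
apply: big_ind => // l _; case: Sa => i Ta.
by rewrite mulrA; apply: (@poly_below_mulXn i); rewrite mulrC; apply: poly_belowZ.
Qed.

(** Hilbert's basis theorem, without generators: [L n i] is the ideal of the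
    coefficients of [x ^+ i] in the elements of [I n] that are polynomial
    expressions of degree at most [i]. It increases in both [n] and [i], so
    only finitely many chains of coefficient ideals matter: the diagonal one,
    and the rows below the index where the diagonal stabilizes. Once they are all
    stationary, an element of [I n] is brought into [I M] by cancelling its top
    coefficient. The expression of an element as a polynomial in [x] need not be
    unique. *)
Theorem hilbert_acc : acc S -> acc (adjoin S x).
Proof.
move=> accS I idI sI.
pose L n i : set R := [set c | S c /\ exists q, T i q /\ I n (c * x ^+ i + q)].
have idL n i : ideal_in S (L n i).
  have [subI I0 ID IM] := idI n; case: (subringS) => S1 SB SM.
  split=> [c []//||a b [Sa [p [Tp Ip]]] [Sb [q [Tq Iq]]]|c a Sc [Sa [p [Tp Ip]]]].
  - split; first exact: subring0.
    by exists 0; split; [apply: poly_below0 | rewrite mul0r addr0].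
  - split; first exact: subringD.
    exists (p + q); split; first exact: poly_belowD.
    by rewrite mulrDl addrACA; apply: ID.
  - split; first exact: SM.
    exists (c * p); split; first exact: poly_belowZ.
    by rewrite -mulrA -mulrDr; apply: IM => //; apply: sub_adjoin.
have sLn i n : L n i `<=` L n.+1 i.
  by move=> c [Sc [q [Tq Iq]]]; split=> //; exists q; split=> //; apply: sI.
have sLi n i : L n i `<=` L n i.+1.
  move=> c [Sc [q [Tq Iq]]]; split=> //; exists (q * x); split.
    exact: poly_below_mulx.
  have [_ _ _ IM] := idI n.
  by rewrite exprSr mulrA -mulrDl mulrC; apply: IM => //; apply: adjoin_gen.
have leLn i := chain_le (sLn i); have leLi n := chain_le (sLi n).
have [N stabN] : exists N, forall n, (N <= n)%N -> L n n `<=` L N N.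
  by apply: accS => // n; apply: subset_trans (sLn _ _) (sLi _ _).
have [f stabf] : {f : nat -> nat &
    forall i n, (f i <= n)%N -> L n i `<=` L (f i) i}.
  apply: (@choice _ _ (fun i N => forall n, (N <= n)%N -> L n i `<=` L N i)) => i.
  exact: accS.
pose M := maxn N (\max_(i < N) f i).
have stabL i n : L n i `<=` L M i.
  have [ltiN|leNi] := ltnP i N.
    have lefM : (f i <= M)%N.
      by apply/(leq_trans _ (leq_maxr _ _))/(leq_bigmax (Ordinal ltiN)).
    apply: (subset_trans _ (leLn _ _ _ lefM)).
    apply: (subset_trans (leLn _ _ _ (leq_maxl n (f i)))).
    by apply: stabf; rewrite leq_maxr.
  apply: (@subset_trans _ (L (maxn n i) (maxn n i))).
    apply: (subset_trans (leLn _ _ _ (leq_maxl n i))).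
    by apply: leLi; rewrite leq_maxr.
  apply: (@subset_trans _ (L N N)).
    by apply: stabN; rewrite leq_max leNi orbT.
  exact: (subset_trans (leLi _ _ _ leNi) (leLn _ _ _ (leq_maxl _ _))).
exists M => n leMn a Ia; have [subI I0 ID IM] := idI n.
have [i Ta] := subI a Ia.
elim: i => [|i ih] in a Ia Ta *.
  by case: Ta => c [_ ->]; rewrite big_ord0; case: (idI M).
have /poly_belowS [c [q [Sc Tq def_a]]] := Ta.
have [_ [q' [Tq' Iq']]] : L M i c.
  by apply: (stabL _ n); split=> //; exists q; rewrite -def_a.
have -> : a = (c * x ^+ i + q') + (q - q') by rewrite def_a addrACA subrr addr0.
have [_ _ IMD _] := idI M; apply: (IMD _ _ Iq').
apply: ih; last exact: poly_belowB.
have -> : q - q' = a + -1 * (c * x ^+ i + q').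
  by rewrite mulN1r def_a opprD addrACA subrr add0r.
apply: ID => //; apply: IM; first by apply: sub_adjoin; apply: subringN => //; case: subringS.
exact: chain_le sI _ _ leMn _ Iq'.
Qed.

End Adjoin.

Lemma acc_foldr_adjoin S (xs : seq R) : subring S -> acc S ->
  let T := foldr (fun x U => adjoin U x) S xs in
  [/\ subring T, acc T, S `<=` T & forall x, x \in xs -> T x].
Proof.
move=> subS accS; elim: xs => [|x xs [subT accT ST xsT]] /=; first by split.
split.
- exact: adjoin_subring.
- exact: hilbert_acc.
- by apply: (subset_trans ST); apply: sub_adjoin.
- move=> y; rewrite inE => /predU1P[->|/xsT]; first exact: adjoin_gen.
  exact: sub_adjoin.
Qed.

End HilbertBasis.

(** * Finite products of primes inside an ideal *)

Section PrimeProducts.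
Variable R : comNzRingType.
Implicit Types (I J P : set R) (Ps Qs : seq (set R)).

Lemma ideal_sum I (T : finType) (F : T -> R) :
  ideal I -> (forall i, I (F i)) -> I (\sum_i F i).
Proof. by move=> [I0 ID _] IF; apply: big_ind. Qed.

Lemma ideal_colon I p : ideal I -> ideal [set b | I (p * b)].
Proof.
move=> [I0 ID IM]; split=> /= [|a b Ia Ib|c a Ia]; first by rewrite mulr0.
  by rewrite mulrDr; apply: ID.
by rewrite mulrCA; apply: IM.
Qed.

Lemma prime_idealP P :
  prime_ideal P <-> [/\ ideal P, ~ P 1 & forall a b, P (a * b) -> P a \/ P b].
Proof.
split=> [[[P0 P1 PL] PM]|[[P0 PD PM] P1 Pprime]].
  split.
  - split=> [|a b Pa Pb|c a Pa]; first by move: P0; rewrite in_setE.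
      by rewrite -[a]mul1r; move: (PL 1 a b); rewrite !in_setE; apply.
    by rewrite -[_ * _]addr0; move: (PL c a 0); rewrite !in_setE; apply=> //;
      move: P0; rewrite in_setE.
  - by move: P1; rewrite notin_setE.
  - by move=> a b Pab; move: (PM a b); rewrite !in_setE => /(_ Pab) /orP[];
      rewrite in_setE; [left | right].
split.
  split; rewrite ?in_setE ?notin_setE //.
  by move=> c a b; rewrite !in_setE => Pa Pb; apply: PD => //; apply: PM.
by move=> a b; rewrite in_setE => /Pprime[] ?; apply/orP; [left | right]; rewrite in_setE.
Qed.

(** The product of the sets in [Ps] lies in [I], expressed through the colon
    ideals of [I] to allow induction on [Ps]. *)
Fixpoint product_sub Ps I : Prop :=
  if Ps is P :: Ps' then forall p, P p -> product_sub Ps' [set b | I (p * b)] else I 1.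

Lemma product_sub_le Ps I J : I `<=` J -> product_sub Ps I -> product_sub Ps J.
Proof.
elim: Ps I J => [|P Ps ih] I J sIJ /=; first exact: sIJ.
by move=> cI p Pp; apply: ih (cI p Pp) => b; apply: sIJ.
Qed.

Lemma product_sub_cat Ps Qs I J : product_sub Ps J ->
  (forall c, J c -> product_sub Qs [set b | I (c * b)]) -> product_sub (Ps ++ Qs) I.
Proof.
elim: Ps I J => [|P Ps ih] I J /= cJ cI.
  by apply: product_sub_le (cI 1 cJ) => b /=; rewrite mul1r.
move=> p Pp; apply: ih (cJ p Pp) _ => c Jpc.
by apply: product_sub_le (cI _ Jpc) => b /=; rewrite mulrA.
Qed.

Lemma product_sub_prime Ps I P : prime_ideal P -> I `<=` P -> product_sub Ps I ->
  exists2 Q, Q \in Ps & Q `<=` P.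
Proof.
move=> /prime_idealP [idP P1 primeP].
elim: Ps I => [|Q Ps ih] I sIP /= cI; first by case: P1; apply: sIP.
have [sQP|/existsNP [q /not_implyP [Qq Pq]]] := pselect (Q `<=` P).
  by exists Q; rewrite // mem_head.
have [b /sIP /primeP [/Pq|]//|Q' Q'Ps sQ'P] := ih _ _ (cI q Qq).
by exists Q' => //; rewrite inE Q'Ps orbT.
Qed.

Definition add_principal I a : set R := [set c | exists i r, I i /\ c = i + r * a].

Lemma add_principal_ideal I a : ideal I -> ideal (add_principal I a).
Proof.
move=> [I0 ID IM]; split.
- by exists 0, 0; rewrite mul0r addr0.
- move=> _ _ [i [r [Ii ->]]] [j [s [Ij ->]]]; exists (i + j), (r + s).
  by split; [apply: ID | rewrite mulrDl addrACA].
- move=> c _ [i [r [Ii ->]]]; exists (c * i), (c * r).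
  by split; [apply: IM | rewrite mulrDr mulrA].
Qed.

Lemma sub_add_principal I a : I `<=` add_principal I a.
Proof. by move=> i Ii; exists i, 0; rewrite mul0r addr0. Qed.

Lemma add_principal_gen I a : ideal I -> add_principal I a a.
Proof. by move=> [I0 _ _]; exists 0, 1; rewrite mul1r add0r. Qed.

(** [(I + (a)) (I + (b))] is contained in [I] when [a * b] is in [I]. *)
Lemma product_sub_split Ps Qs I a b : ideal I -> I (a * b) ->
  product_sub Ps (add_principal I a) -> product_sub Qs (add_principal I b) ->
  product_sub (Ps ++ Qs) I.
Proof.
move=> [I0 ID IM] Iab cPs cQs; apply: product_sub_cat cPs _ => _ [i [r [Ii ->]]].
apply: product_sub_le cQs => _ [j [s [Ij ->]]] /=.
rewrite mulrDl; apply: (ID); first by rewrite mulrC; apply: (IM).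
rewrite mulrDr; apply: (ID); first exact: IM.
by rewrite mulrACA; apply: IM.
Qed.

Definition contains_prime_product I : Prop :=
  exists2 Ps, (forall P, P \in Ps -> prime_ideal P /\ I `<=` P) & product_sub Ps I.

(** Noetherian induction: an ideal [J] without this property is proper and not
    prime, so [a * b] is in [J] for some [a], [b] outside [J]. One of [J + (a)]
    and [J + (b)] again fails, by [product_sub_split], and iterating this step
    gives a chain that never stops. *)
Theorem acc_contains_prime_product I : acc [set: R] -> ideal I -> contains_prime_product I.
Proof.
move=> accR; apply: contrapT => /not_implyP [idI badI].
pose is_bad (J : set R) := ideal J /\ ~ contains_prime_product J.
pose bad := {J : set R | is_bad J}.
have grow (J : bad) : exists K : bad, sval J `<=` sval K /\ ~ sval K `<=` sval J.
  case: J => J [idJ badJ] /=.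
  have step a : ~ J a -> ~ contains_prime_product (add_principal J a) ->
      exists K : bad, J `<=` sval K /\ ~ sval K `<=` J.
    move=> nJa badK; exists (exist is_bad _ (conj (add_principal_ideal a idJ) badK)).
    by split=> /= [|sKJ]; [apply: sub_add_principal | apply/nJa/sKJ/add_principal_gen].
  apply: contrapT => noK; apply: (badJ).
  have good c : ~ J c -> contains_prime_product (add_principal J c).
    by move=> nJc; apply: contrapT => badK; apply/noK/(step c).
  have nJ1 : ~ J 1 by move=> J1; apply: badJ; exists [::].
  exists [:: J] => [P|p Jp /=]; last by rewrite mulr1.
  rewrite inE => /eqP ->; split=> //; apply/prime_idealP; split=> // a b Jab.
  apply: contrapT => /not_orP [/good [Ps primePs cPs] /good [Qs primeQs cQs]].
  apply: badJ; exists (Ps ++ Qs); last by apply: (product_sub_split idJ Jab).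
  move=> Q; rewrite mem_cat => /orP[/primePs|/primeQs] [primeQ sQ]; split=> //.
    by apply: subset_trans sQ; apply: sub_add_principal.
  by apply: subset_trans sQ; apply: sub_add_principal.
have [f fP] : {f : bad -> bad & 
    forall J : bad, sval J `<=` sval (f J) /\ ~ sval (f J) `<=` sval J}.
  by apply: (@choice _ _ (fun J K : bad => sval J `<=` sval K /\ ~ sval K `<=` sval J)).
pose C n := iter n f (exist is_bad I (conj idI badI)).
have [n|n|N stabN] := accR (fun n => sval (C n)).
- by case: (svalP (C n)) => -[C0 CD CM] _; split=> // c a _; apply: CM.
- by case: (fP (C n)).
- by case: (fP (C N)) => _; apply; apply: (stabN N.+1).
Qed.

End PrimeProducts.

(** * Components and generators of a standard graded algebra *)

Section StandardGraded.
Variables (k : fieldType) (A : comAlgType k) (A_ : nat -> set A).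
Hypothesis hA : standard_graded A_.
Let gA := standard_graded_algebra hA.

Lemma graded0 n : A_ n 0.
Proof. by have [] := graded_submod gA n; rewrite in_setE. Qed.

Lemma gradedP n c a b : A_ n a -> A_ n b -> A_ n (c *: a + b).
Proof. by have [_ /(_ c a b)] := graded_submod gA n; rewrite !in_setE; apply. Qed.

Lemma gradedZ n c a : A_ n a -> A_ n (c *: a).
Proof. by move=> Aa; rewrite -[_ *: _]addr0; apply/gradedP/graded0. Qed.

Lemma gradedD n a b : A_ n a -> A_ n b -> A_ n (a + b).
Proof. by move=> Aa Ab; rewrite -[a]scale1r; apply: gradedP. Qed.

Lemma gradedB n a b : A_ n a -> A_ n b -> A_ n (a - b).
Proof. by move=> Aa Ab; apply: gradedD => //; rewrite -scaleN1r; apply: gradedZ. Qed.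

Lemma graded_bigsum n (T : finType) (F : T -> A) :
  (forall i, A_ n (F i)) -> A_ n (\sum_i F i).
Proof. by move=> AF; apply: big_ind => //; [apply: graded0 | apply: gradedD]. Qed.

Lemma graded_scalar c : A_ 0%N (c%:A).
Proof. by rewrite (standard_degree0 hA); exists c. Qed.

Lemma sum_pad (c : nat -> A) N K : (N <= K)%N ->
  \sum_(n < N) c n = \sum_(n < K) (if (n < N)%N then c n else 0).
Proof. by move=> leNK; rewrite (big_ord_widen K c leNK) big_mkcond. Qed.

Lemma has_components a : exists c : nat -> A, (forall n, A_ n (c n)) /\
  exists N, (forall n, (N <= n)%N -> c n = 0) /\ a = \sum_(n < N) c n.
Proof.
have [N [c [Ac ->]]] := graded_sum gA a.
exists (fun n => if (n < N)%N then c n else 0); split=> [n|].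
  by case: ifP => // _; apply: graded0.
exists N; split=> [n|]; first by rewrite ltnNge => ->.
by apply: sum_pad.
Qed.

Definition component a : nat -> A := sval (cid (has_components a)).

Lemma component_graded a n : A_ n (component a n).
Proof. by rewrite /component; case: cid => c []. Qed.

Lemma component_sum a : exists N, forall K, (N <= K)%N -> a = \sum_(n < K) component a n.
Proof.
rewrite /component; case: cid => c [_ [N [c0 def_a]]] /=; exists N => K leNK.
rewrite [LHS]def_a (sum_pad c leNK); apply: eq_bigr => n _.
by case: ltnP => // /c0 ->.
Qed.

Lemma component_unique a N (c : nat -> A) : (forall n, A_ n (c n)) ->
  a = \sum_(n < N) c n -> forall n, component a n = if (n < N)%N then c n else 0.
Proof.
move=> Ac def_a n; have [N' def_a'] := component_sum a.
pose K := maxn (maxn N N') n.+1.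
pose e j := component a j - (if (j < N)%N then c j else 0).
apply/eqP; rewrite -subr_eq0 -/(e n); apply/eqP.
apply: (graded_direct gA (N := K)) => [j||]; last by rewrite leq_maxr.
  apply: gradedB; first exact: component_graded.
  by case: ifP => // _; apply: graded0.
rewrite sumrB -def_a' -?sum_pad -?def_a ?subrr //.
  by rewrite !leq_max leqnn.
by rewrite !leq_max leqnn orbT.
Qed.

Lemma componentD a b n : component (a + b) n = component a n + component b n.
Proof.
have [N def_a] := component_sum a; have [N' def_b] := component_sum b.
pose K := maxn (maxn N N') n.+1.
rewrite (@component_unique _ K (fun j => component a j + component b j)).
- by rewrite leq_maxr.
- by move=> j; apply: gradedD; apply: component_graded.
- by rewrite big_split /= -def_a -?def_b // !leq_max leqnn ?orbT.
Qed.

Lemma component_homog n a j : A_ n a -> component a j = if j == n then a else 0.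
Proof.
move=> Aa; rewrite (@component_unique _ n.+1 (fun i => if i == n then a else 0)).
- by case: eqP => [->|_]; rewrite ?leqnn // if_same.
- by move=> i; case: eqP => [->|_] //; apply: graded0.
rewrite big_ord_recr /= eqxx big1 ?add0r // => i _.
by rewrite ltn_eqF.
Qed.

Lemma component0 n : component 0 n = 0.
Proof. by rewrite (component_homog _ (graded0 n)) if_same. Qed.

Lemma component_bigsum (T : finType) (F : T -> A) n :
  component (\sum_i F i) n = \sum_i component (F i) n.
Proof.
by apply: (big_morph (fun a => component a n)) => [a b|];
  [apply: componentD | apply: component0].
Qed.

Lemma componentM_homog a b j n : A_ j b ->
  component (a * b) n = if (j <= n)%N then component a (n - j) * b else 0.
Proof.
move=> Ab; have [N def_a] := component_sum a; pose K := maxn N n.+1.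
pose c i := if (j <= i)%N then component a (i - j) * b else 0.
rewrite (@component_unique _ (j + K) c).
- by rewrite (leq_trans (leq_maxr N n.+1)) ?leq_addl.
- move=> i; rewrite /c; case: leqP => [leji|_]; last exact: graded0.
  rewrite -{1}(subnK leji); apply: (graded_mul gA) => //.
  exact: component_graded.
rewrite big_split_ord /= big1 ?add0r => [|i _]; last by rewrite /c leqNgt ltn_ord.
rewrite {1}(def_a K (leq_maxl _ _)) mulr_suml; apply: eq_bigr => i _.
by rewrite /c leq_addr addKn.
Qed.

(** The projection onto degree 0 is a ring morphism. *)
Lemma component0M a b : component (a * b) 0 = component a 0 * component b 0.
Proof.
have [N /(_ N.+1 (leqnSn N)) {1}->] := component_sum b.
rewrite mulr_sumr component_bigsum big_ord_recl /=.
rewrite (componentM_homog _ _ (component_graded b 0)) /= subn0.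
rewrite big1 ?addr0 // => i _.
by rewrite (componentM_homog _ _ (component_graded b _)).
Qed.

Lemma component0_scalar a : exists c : k, component a 0 = c%:A.
Proof.
have := component_graded a 0; rewrite (standard_degree0 hA) => -[c _ <-].
by exists c.
Qed.

Definition irrelevant : set A := [set a | component a 0 = 0].

(** The quotient by the irrelevant ideal is [A_0 = k]. *)
Lemma irrelevant_prime : prime_ideal irrelevant.
Proof.
apply/prime_idealP; rewrite /irrelevant /=; split.
- split=> /= [|a b a0 b0|c a a0]; first exact: component0.
    by rewrite componentD a0 b0 addr0.
  by rewrite component0M a0 mulr0.
- rewrite (@component_homog 0) ?eqxx; last by rewrite -(scale1r 1); apply: graded_scalar.
  by apply/eqP; apply: oner_neq0.
move=> a b; rewrite component0M.
have [c ->] := component0_scalar a; have [e ->] := component0_scalar b.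
rewrite -scalerAl mul1r scalerA => /eqP.
by rewrite scaler_eq0 oner_eq0 orbF mulf_eq0 => /orP[]/eqP ->; rewrite scale0r; [left | right].
Qed.

Lemma degree1_irrelevant : A_ 1%N `<=` irrelevant.
Proof. by move=> a Aa; rewrite /irrelevant /= (component_homog _ Aa). Qed.

Definition family_ideal n (z : 'I_n -> A) : set A :=
  [set a | exists g : 'I_n -> A, a = \sum_i g i * z i].

Lemma family_ideal_ideal n (z : 'I_n -> A) : ideal (family_ideal z).
Proof.
split=> [|_ _ [g ->] [h ->]|c _ [g ->]].
- by exists (fun=> 0); rewrite big1 // => i _; rewrite mul0r.
- by exists (fun i => g i + h i); rewrite -big_split; apply: eq_bigr => i _; rewrite mulrDl.
- by exists (fun i => c * g i); rewrite mulr_sumr; apply: eq_bigr => i _; rewrite mulrA.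
Qed.

Lemma family_ideal_gen n (z : 'I_n -> A) i : family_ideal z (z i).
Proof.
exists (fun j => (j == i)%:R); rewrite (bigD1 i) //= eqxx mul1r big1 ?addr0 // => j.
by move/negPf->; rewrite mul0r.
Qed.

Lemma family_ideal_sub n (z : 'I_n -> A) I :
  ideal I -> (forall i, I (z i)) -> family_ideal z `<=` I.
Proof.
move=> idI Iz _ [g ->]; apply: ideal_sum => // i.
by case: idI => _ _ IM; apply: IM.
Qed.

Lemma smallest_ideal_range n (z : 'I_n -> A) : smallest ideal (range z) = family_ideal z.
Proof.
apply/seteqP; split=> [a|a fa I [idI sI]].
  apply; split=> [|_ [i _ <-]]; first exact: family_ideal_ideal.
  exact: family_ideal_gen.
by apply: family_ideal_sub fa => // i; apply: sI; exists i.
Qed.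

Section LinearFamily.
Variables (n : nat) (z : 'I_n -> A).
Hypothesis z1 : forall i, A_ 1%N (z i).

Lemma family_ideal_degree0 a : A_ 0%N a -> family_ideal z a -> a = 0.
Proof.
move=> Aa [g def_a]; have := component_homog 0 Aa; rewrite eqxx => <-.
rewrite def_a component_bigsum big1 // => i _.
by rewrite (componentM_homog _ _ (z1 i)).
Qed.

Lemma family_ideal_homog a j : A_ j.+1 a -> family_ideal z a ->
  exists g : 'I_n -> A, (forall i, A_ j (g i)) /\ a = \sum_i g i * z i.
Proof.
move=> Aa [g def_a]; exists (fun i => component (g i) j); split=> [i|].
  exact: component_graded.
have := component_homog j.+1 Aa; rewrite eqxx => {1}<-.
rewrite def_a component_bigsum; apply: eq_bigr => i _.
by rewrite (componentM_homog _ _ (z1 i)) /= subn1.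
Qed.

Lemma family_ideal_component a j : family_ideal z a -> family_ideal z (component a j).
Proof.
move=> [g ->]; rewrite component_bigsum; apply: ideal_sum => [|i].
  exact: family_ideal_ideal.
rewrite (componentM_homog _ _ (z1 i)); have [f0 _ fM] := family_ideal_ideal z.
by case: ifP => // _; apply/fM/family_ideal_gen.
Qed.

Lemma family_ideal_graded : graded_ideal A_ (family_ideal z).
Proof.
split=> [|N c Ac fc j ltjN]; first exact: family_ideal_ideal.
by have := family_ideal_component j fc; rewrite (component_unique Ac erefl) ltjN.
Qed.

End LinearFamily.

Section Generators.
Variables (m : nat) (x : 'I_m -> A).
Hypothesis hx : A_ 1%N = range (fun c : 'I_m -> k => \sum_(j < m) c j *: x j).

Lemma degree1_gen j : A_ 1%N (x j).
Proof.
rewrite hx; exists (fun i => (i == j)%:R) => //.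
rewrite (bigD1 j) //= eqxx scale1r big1 ?addr0 // => i /negPf ->.
by rewrite scale0r.
Qed.

Lemma subalg_eq_setT (S : set A) : S 1 ->
  (forall c a b, S a -> S b -> S (c *: a + b)) ->
  (forall a b, S a -> S b -> S (a * b)) -> (forall j, S (x j)) -> forall a, S a.
Proof.
move=> S1 SL SM Sx a.
have : [set: A] a by []; rewrite -(standard_generated hA); apply; split.
  by split=> [|c u v|u v]; rewrite !in_setE //; [apply: SL | apply: SM].
have S0 : S 0 by have := SL (-1) _ _ S1 S1; rewrite scaleN1r addNr.
rewrite hx => _ [c _ <-]; apply: big_ind => // [u v Su Sv|j _].
  by rewrite -[u]scale1r; apply: SL.
by rewrite -[_ *: _]addr0; apply: SL.
Qed.

Fixpoint monomial_span n : set A :=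
  if n is n'.+1 then
    [set a | exists w : 'I_m -> A, (forall j, monomial_span n' (w j)) /\ a = \sum_j w j * x j]
  else A_ 0%N.

Lemma monomial_span_graded n : monomial_span n `<=` A_ n.
Proof.
elim: n => [a|n ih _ [w [Ww ->]]]; first exact.
apply: graded_bigsum => j.
by rewrite -addn1; apply: (graded_mul gA); [exact: ih (Ww j) | apply: degree1_gen].
Qed.

Lemma monomial_spanP n c a b :
  monomial_span n a -> monomial_span n b -> monomial_span n (c *: a + b).
Proof.
elim: n a b => [|n ih] a b; first exact: gradedP.
move=> [v [Wv ->]] [w [Ww ->]]; exists (fun j => c *: v j + w j); split=> [j|].
  exact: ih (Wv j) (Ww j).
rewrite scaler_sumr -big_split; apply: eq_bigr => j _ /=.
by rewrite mulrDl -scalerAl.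
Qed.

Lemma monomial_span0 n : monomial_span n 0.
Proof.
elim: n => [|n ih]; first exact: graded0.
by exists (fun=> 0); split=> //; rewrite big1 // => j _; rewrite mul0r.
Qed.

Lemma monomial_spanM i j a b :
  monomial_span i a -> monomial_span j b -> monomial_span (i + j) (a * b).
Proof.
elim: i a => [|i ih] a /=.
  rewrite (standard_degree0 hA) => -[c _ <-] Wb.
  rewrite -scalerAl mul1r -[_ *: _]addr0.
  by apply: monomial_spanP => //; apply: monomial_span0.
move=> [w [Ww ->]] Wb; exists (fun l => w l * b); split=> [l|]; first exact: ih (Ww l) Wb.
by rewrite mulr_suml; apply: eq_bigr => l _; rewrite mulrAC.
Qed.

Lemma sum_monomial_span a :
  exists N (c : nat -> A), (forall n, monomial_span n (c n)) /\ a = \sum_(n < N) c n.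
Proof.
pose S : set A := [set a | exists N (c : nat -> A),
  (forall n, monomial_span n (c n)) /\ a = \sum_(n < N) c n].
have WS n b : monomial_span n b -> S b.
  move=> Wb; exists n.+1, (fun i => if i == n then b else 0); split=> [i|].
    by case: eqP => [->|_] //; apply: monomial_span0.
  rewrite big_ord_recr /= eqxx big1 ?add0r // => i _.
  by rewrite ltn_eqF.
have SL c u v : S u -> S v -> S (c *: u + v).
  move=> [N [f [Wf ->]]] [K [g [Wg ->]]]; exists (maxn N K).
  exists (fun n => c *: (if (n < N)%N then f n else 0) + (if (n < K)%N then g n else 0)).
  split=> [n|]; last first.
    by rewrite big_split -scaler_sumr -!sum_pad // leq_max leqnn ?orbT.
  by apply: monomial_spanP; case: ifP => // _; apply: monomial_span0.
have S1 : S 1 by apply: (WS 0%N); rewrite -(scale1r 1); apply: graded_scalar.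
have S0 : S 0 by apply/(WS 0%N)/monomial_span0.
have SD u v : S u -> S v -> S (u + v) by rewrite -{2}[u]scale1r; apply: SL.
apply: (@subalg_eq_setT S) => // [_ _ [N [f [Wf ->]]] [K [g [Wg ->]]]|j].
  rewrite mulr_suml; apply: big_ind => // i _; rewrite mulr_sumr.
  apply: big_ind => // j _.
  by apply/(WS (i + j)%N)/monomial_spanM.
apply: (WS 1%N); exists (fun i => (i == j)%:R); split=> [i|].
  by rewrite -[_%:R]mulr1 mulr_natl -scaler_nat; apply: graded_scalar.
by rewrite (bigD1 j) //= eqxx mul1r big1 ?addr0 // => i /negPf ->; rewrite mul0r.
Qed.

Lemma graded_monomial_span n a : A_ n a -> monomial_span n a.
Proof.
move=> Aa; have [N [c [Wc def_a]]] := sum_monomial_span a.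
have := component_homog n Aa; rewrite eqxx => <-.
rewrite (@component_unique _ N c) //.
  by case: ifP => // _; apply: monomial_span0.
by move=> j; apply/monomial_span_graded.
Qed.

(** As [A] is generated in degree 1, monomials of degree [n] in the [x j] span
    [A_ n]: this is how multiplication by [A_ 1] is seen to reach all of
    [A_ n.+1]. *)
Lemma gradedS n a : A_ n.+1 a ->
  exists w : 'I_m -> A, (forall j, A_ n (w j)) /\ a = \sum_j w j * x j.
Proof.
move=> /graded_monomial_span [w [Ww ->]]; exists w; split=> // j.
exact: monomial_span_graded (Ww j).
Qed.

Lemma graded_sub_ideal I n j : ideal I -> A_ n `<=` I -> A_ (j + n)%N `<=` I.
Proof.
move=> idI sAI; elim: j => [|j ih _ /gradedS [w [Aw ->]]]; first exact.
by apply: ideal_sum => // i; rewrite mulrC; case: (idI) => _ _ IM; apply/IM/ih.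
Qed.

Lemma scalars_subring : subring (range (fun c : k => c%:A : A)).
Proof.
split; first by exists 1; rewrite ?scale1r.
  by move=> _ _ [a _ <-] [b _ <-]; exists (a - b); rewrite // scalerBl.
by move=> _ _ [a _ <-] [b _ <-]; exists (a * b); rewrite // -scalerAl mul1r scalerA.
Qed.

Lemma scalars_acc : acc (range (fun c : k => c%:A : A)).
Proof.
move=> I idI sI.
have [[N [c Ic c0]]|I0] := pselect (exists N, exists2 c : k, I N c%:A & c != 0).
  exists N => n _ a /= Ia; have [sub _ _ _] := idI n; have [e _ <-] := sub a Ia.
  have [_ _ _ IM] := idI N.
  have -> : e%:A = (e / c)%:A * c%:A :> A by rewrite -scalerAl mul1r scalerA divfK.
  by apply: IM => //; exists (e / c).
exists 0%N => n _ a Ia; have [sub _ _ _] := idI n; have [e _ def_a] := sub a Ia.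
have [_ I00 _ _] := idI 0%N.
have [e0|e0] := eqVneq e 0; first by rewrite -def_a e0 scale0r.
by case: I0; exists n, e => //; rewrite def_a.
Qed.

Theorem standard_graded_acc : acc [set: A].
Proof.
have [] := acc_foldr_adjoin (codom x) scalars_subring scalars_acc.
set T := foldr _ _ _ => subT accT sT xT.
suff -> : [set: A] = T by [].
apply/seteqP; split=> // a _; case: (subT) => T1 TB TM.
apply: subalg_eq_setT => // [c u v Tu Tv|j]; last by apply: xT; apply: codom_f.
apply: subringD => //; rewrite -[u]mul1r scalerAl; apply: TM => //.
by apply: sT; exists c.
Qed.

End Generators.
End StandardGraded.

(** * Reductions generated by as many linear forms as the dimension *)

Section Avoidance.
Variables (k : closedFieldType) (V : lmodType k).
Implicit Types U P : set V.

Lemma closed_field_fresh (s : seq k) : exists t, t \notin s.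
Proof.
pose p := \prod_(a <- s) ('X - a%:P) : {poly k}.
have /closed_nonrootP [t] : p != 0 by apply/monic_neq0/monic_prod_XsubC.
by rewrite root_prod_XsubC; exists t.
Qed.

Definition subspace P : Prop := P 0 /\ forall c u v, P u -> P v -> P (c *: u + v).

(** If [v] avoids the tail of [Ps] and [w] is outside its head [P], while [v] is
    in [P], then [t *: v + w] is outside [P] for all [t], and inside each
    other member for at most one [t], since [v] is outside that member. *)
Lemma subspace_avoidance U (Ps : seq (set V)) : subspace U ->
  (forall P, P \in Ps -> subspace P /\ ~ U `<=` P) ->
  exists2 v, U v & forall P, P \in Ps -> ~ P v.
Proof.
move=> [U0 UL]; elim: Ps => [|P Ps ih] hPs; first by exists 0.
have [Q QPs|v Uv vPs] := ih; first by apply: hPs; rewrite inE QPs orbT.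
have [[P0 PL] /existsNP [w /not_implyP [Uw nPw]]] := hPs P (mem_head _ _).
have [Pv|nPv] := pselect (P v); last first.
  by exists v => // Q; rewrite inE => /predU1P [->|/vPs].
pose bad Q := xget 0 [set t | Q (t *: v + w)].
have [t tbad] := closed_field_fresh [seq bad Q | Q <- Ps].
exists (t *: v + w); first exact: UL.
move=> Q; rewrite inE => /predU1P [-> Ptvw|QPs Qt].
  by apply: nPw; have := PL (- t) _ _ Pv Ptvw; rewrite scaleNr addKr.
have [[Q0 QL] _] : subspace Q /\ ~ U `<=` Q by apply: hPs; rewrite inE QPs orbT.
have Qbad : Q (bad Q *: v + w) by apply: (@xgetPex _ 0 [set t | Q (t *: v + w)]); exists t.
have neq : t - bad Q != 0.
  by rewrite subr_eq0; apply: contraNneq tbad => ->; apply: map_f.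
apply: (vPs Q QPs).
have Qd : Q ((t - bad Q) *: v).
  have := QL (-1) _ _ Qbad Qt.
  by rewrite scaleN1r opprD addrACA addNr addr0 addrC -scalerBl.
have := QL (t - bad Q)^-1 _ _ Qd Q0.
by rewrite addr0 scalerA mulVf // scale1r.
Qed.

End Avoidance.

Section SystemOfParameters.
Variables (k : closedFieldType) (A : comAlgType k) (A_ : nat -> set A).
Hypothesis hA : standard_graded A_.
Variables (m : nat) (x : 'I_m -> A).
Hypothesis hx : A_ 1%N = range (fun c : 'I_m -> k => \sum_(j < m) c j *: x j).

Lemma ideal_subspace (I : set A) : ideal I -> subspace I.
Proof.
move=> [I0 ID IM]; split=> // c u v Iu Iv; apply: ID => //.
by rewrite -mulr_algl; apply: IM.
Qed.

Lemma degree1_subspace : subspace (A_ 1%N).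
Proof. by split=> [|c u v]; [apply: (graded0 hA) | apply: (gradedP hA)]. Qed.

Lemma prime_chain_extend n C (P : set A) : prime_chain n C -> C n `<` P ->
  prime_ideal P ->
  prime_chain n.+1 (fun i => if (i <= n)%N then C i else P).
Proof.
move=> [primeC sC] sCP primeP; split=> i; first by case: (leqP i n) => // ? _; apply: primeC.
rewrite ltnS => lein; rewrite lein; move: lein; rewrite leq_eqVlt.
by case/predU1P => [->|ltin]; rewrite ?ltnn // ltin; apply: sC.
Qed.

(** A prime that contains the chosen forms [y 0, ..., y n] contains one of the
    primes attached to [(y 0, ..., y (n - 1))]; like the given prime, that one does
    not contain [A_ 1], hence does not contain [y n] by the choice of [y n]. So
    the inclusion is strict, and its own chain is available by induction. *)
Lemma parameters_prime_chain n : exists y : nat -> A, (forall j, A_ 1%N (y j)) /\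
  forall P, prime_ideal P -> ~ A_ 1%N `<=` P -> (forall j, (j < n)%N -> P (y j)) ->
  exists C, prime_chain n C /\ C n = P.
Proof.
elim: n => [|n [y [y1 yP]]].
  exists (fun=> 0); split=> [_|P primeP _ _]; first exact: (graded0 hA).
  by exists (fun=> P); split.
pose I := family_ideal (fun j : 'I_n => y j).
have idI : ideal I := family_ideal_ideal _.
have [Ps hPs cPs] := acc_contains_prime_product (standard_graded_acc hA hx) idI.
have [Q|z z1 zPs] := subspace_avoidance (Ps := [seq Q <- Ps | ~~ `[< A_ 1%N `<=` Q >]])
  degree1_subspace.
  rewrite mem_filter => /andP[/asboolPn ? /hPs [/prime_idealP [idQ _ _] _]].
  by split=> //; apply: ideal_subspace.
exists (fun j => if (j < n)%N then y j else z); split=> [j|P primeP nAP yzP].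
  by case: ifP.
have yPP j : (j < n)%N -> P (y j).
  by move=> ltjn; have := yzP j (ltnW ltjn); rewrite ltjn.
have Pz : P z by have := yzP n (leqnn _); rewrite ltnn.
have [idP _ _] := (prime_idealP P).1 primeP.
have sIP : I `<=` P by apply: family_ideal_sub => // j; apply: yPP.
have [Q QPs sQP] := product_sub_prime primeP sIP cPs.
have [primeQ sIQ] := hPs Q QPs.
have nAQ : ~ A_ 1%N `<=` Q by move=> sAQ; apply/nAP/(subset_trans sAQ).
have [|C [chainC CQ]] := yP Q primeQ nAQ.
  by move=> j ltjn; apply/sIQ/(family_ideal_gen (fun j : 'I_n => y j) (Ordinal ltjn)).
exists (fun i => if (i <= n)%N then C i else P); rewrite ltnn; split=> //.
apply: prime_chain_extend => //; rewrite CQ; split=> // sPQ.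
by apply: (zPs Q); [rewrite mem_filter QPs andbT; apply/asboolPn | apply: sPQ].
Qed.

(** Elements of [I] up to a factor outside the irrelevant ideal, that is, the
    preimage of [I] localized at the irrelevant ideal. *)
Definition saturation (I : set A) : set A :=
  [set b | exists2 f, component hA f 0 <> 0 & I (f * b)].

Lemma component0_neq0M f g : component hA f 0 <> 0 -> component hA g 0 <> 0 ->
  component hA (f * g) 0 <> 0.
Proof.
move=> f0 g0; have /prime_idealP [_ _ prime_irr] := irrelevant_prime hA.
by case/prime_irr.
Qed.

Lemma saturation_ideal I : ideal I -> ideal (saturation I).
Proof.
move=> [I0 ID IM]; have /prime_idealP [_ irr1 _] := irrelevant_prime hA.
split=> [|a b [f f0 Ifa] [g g0 Igb]|c a [f f0 Ifa]].
- by exists 1; rewrite ?mulr0.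
- exists (f * g); first exact: component0_neq0M.
  rewrite mulrDr; apply: ID; first by rewrite mulrAC mulrC; apply: IM.
  by rewrite -mulrA; apply: IM.
- by exists f; rewrite // mulrCA; apply: IM.
Qed.

(** A prime not contained in the irrelevant ideal becomes the unit ideal in the
    localization, so only the factors that contain [A_ 1] count there. *)
Lemma product_sub_saturation Ps I : ideal I -> product_sub Ps I ->
  (forall Q, Q \in Ps -> A_ 1%N `<=` Q \/ ~ Q `<=` irrelevant hA) ->
  A_ (size Ps) `<=` saturation I.
Proof.
elim: Ps I => [|Q Ps ih] I idI /= cI hPs.
  have /prime_idealP [_ irr1 _] := irrelevant_prime hA.
  move=> b _; exists 1; first exact: irr1.
  by rewrite mulrC; case: idI => _ _ IM; apply: IM.
have [satI0 satID satIM] := saturation_ideal idI.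
have hPs' Q' : Q' \in Ps -> A_ 1%N `<=` Q' \/ ~ Q' `<=` irrelevant hA.
  by move=> Q'Ps; apply: hPs; rewrite inE Q'Ps orbT.
move=> a /(gradedS hA hx) [w [Aw ->]]; apply: ideal_sum => [|j].
  exact: saturation_ideal.
case: (hPs Q (mem_head _ _)) => [sAQ|/existsNP [p /not_implyP [Qp p0]]].
  have Qx : Q (x j) := sAQ _ (degree1_gen hx j).
  have [f f0 If] := ih _ (ideal_colon _ idI) (cI _ Qx) hPs' _ (Aw j).
  by exists f => //; rewrite mulrA mulrC.
have [f f0 If] := ih _ (ideal_colon _ idI) (cI _ Qp) hPs' _ (Aw j).
rewrite mulrC; apply: satIM; exists (p * f); first exact: component0_neq0M.
by rewrite -mulrA.
Qed.

(** The prime chain given by [parameters_prime_chain] is prolonged by the irrelevant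
    ideal, whence no prime attached to the ideal of [y 0, ..., y (d - 1)] is both
    inside the irrelevant ideal and different from it. The saturation is then
    removed by taking components: if [f * b] is in a graded ideal and [b] is
    homogeneous, then so is the component of [f * b] of degree [deg b], which is a
    nonzero scalar times [b]. *)
Theorem exists_linear_parameters d : krull_dim_eq A d ->
  exists (z : 'I_d -> A) (s : nat), (forall i, A_ 1%N (z i)) /\ A_ s `<=` family_ideal z.
Proof.
move=> [_ dim_le]; have [y [y1 yP]] := parameters_prime_chain d.
pose z (i : 'I_d) := y i; have z1 i : A_ 1%N (z i) by apply: y1.
have idI : ideal (family_ideal z) := family_ideal_ideal z.
have [Ps hPs cPs] := acc_contains_prime_product (standard_graded_acc hA hx) idI.
exists z, (size Ps); split=> // b Ab.
have [Q QPs|f f0 If] := product_sub_saturation idI cPs _ Ab.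
  have [primeQ sIQ] := hPs Q QPs.
  apply: contrapT => /not_orP [nAQ /contrapT sQirr].
  have [|C [chainC CQ]] := yP Q primeQ nAQ.
    by move=> j ltjd; apply/sIQ/(family_ideal_gen z (Ordinal ltjd)).
  suff /prime_chain_extend : C d `<` irrelevant hA.
    by move=> /(_ chainC (irrelevant_prime hA)) /dim_le; rewrite ltnn.
  rewrite CQ; split=> // s_irrQ; apply: nAQ.
  exact: subset_trans (@degree1_irrelevant _ _ _ hA) s_irrQ.
have := family_ideal_component hA z1 (size Ps) If.
rewrite (componentM_homog hA _ _ Ab) leqnn subnn.
have [c f0c] := component0_scalar hA f; rewrite f0c in f0 *.
have c0 : c != 0 by apply: contra_notN f0 => /eqP ->; rewrite scale0r.
have [_ _ IM] := idI => /(IM c^-1%:A).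
by rewrite -!scalerAl !mul1r scalerA mulVf // scale1r.
Qed.

End SystemOfParameters.

(** * Polynomials over an infinite field and linear algebra *)

Section Nonvanishing.
Variables (k : closedFieldType) (n : nat).

Lemma radix_inj K (f g : 'I_n -> nat) : (forall i, f i < K)%N -> (forall i, g i < K)%N ->
  (\sum_i f i * K ^ i = \sum_i g i * K ^ i)%N -> f =1 g.
Proof.
elim: n f g => [|n' ih] f g ltf ltg; first by move=> _ [].
have K0 : (0 < K)%N := leq_ltn_trans (leq0n _) (ltf ord0).
have shift (h : 'I_n'.+1 -> nat) : (\sum_i h i * K ^ i =
    (\sum_(i < n') h (lift ord0 i) * K ^ i) * K + h ord0)%N.
  rewrite big_ord_recl expn0 muln1 addnC big_distrl /=; congr (_ + _)%N.
  by apply: eq_bigr => i _; rewrite -mulnA -expnSr.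
rewrite !shift => e.
have e0 : f ord0 = g ord0.
  by have := congr1 (modn^~ K) e; rewrite !modnMDl !modn_small.
move: e; rewrite e0 => /addIn /eqP; rewrite eqn_pmul2r // => /eqP /ih e.
move=> i; case: (unliftP ord0 i) => [j|] -> //.
by apply: (e _ _ j).
Qed.

(** Kronecker substitution: replacing the [i]-th indeterminate by the [K ^ i]-th power of a
    single one keeps the monomials of [p] distinct as soon as [K] exceeds all
    exponents, which reduces the claim to polynomials in one indeterminate. *)
Lemma mpoly_nonvanishing (p : {mpoly k[n]}) : p != 0 -> exists v : 'I_n -> k, p.@[v] != 0.
Proof.
move=> p0; pose K := msize p.
pose code (e : 'X_{1..n}) := (\sum_(i < n) e i * K ^ i)%N.
pose q : {poly k} := \sum_(e <- msupp p) p@_e *: 'X^(code e).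
have lt_supp e i : e \in msupp p -> (e i < K)%N.
  move=> pe; apply: leq_ltn_trans (msize_mdeg_lt pe).
  by rewrite mdegE (bigD1 i) //= leq_addr.
have code_inj e e' : e \in msupp p -> e' \in msupp p -> code e = code e' -> e = e'.
  move=> pe pe' ecode; apply/mnmP; apply: (@radix_inj K) ecode => i; exact: lt_supp.
have q0 : q != 0.
  have [e pe] : exists e, e \in msupp p.
    by exists (mlead p); apply: mlead_supp.
  apply: contra_neq (p0) => q0; have : p@_e != 0 by rewrite -mcoeff_msupp.
  case/negP; have := congr1 (fun r : {poly k} => r`_(code e)) q0.
  rewrite coef0 coef_sum (bigD1_seq e) //= ?msupp_uniq // coefZ coefXn eqxx mulr1.
  rewrite big_seq_cond big1 ?addr0 => [->//|e' /andP[pe' ne]].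
  rewrite coefZ coefXn; case: eqP => [/code_inj eqe|]; last by rewrite mulr0.
  by rewrite eqe ?eqxx in ne.
have /closed_nonrootP [t nroot] := q0.
exists (fun i => t ^+ (K ^ i)); apply: contra nroot => /eqP pv.
apply/rootP; rewrite -[RHS]pv mevalE horner_sum; apply: eq_bigr => e _.
rewrite hornerZ hornerXn; congr (_ * _); rewrite /code expr_sum.
by apply: eq_bigr => i _; rewrite mulnC exprM.
Qed.

End Nonvanishing.

Section LinearAlgebra.

Lemma row_span_or_dual (K : fieldType) (T : finType) N (r : T -> 'rV[K]_N) (a : 'rV_N) :
  (exists f : T -> K, a = \sum_t f t *: r t) \/
  (exists w : 'cV_N, (forall t, r t *m w = 0) /\ a *m w <> 0).
Proof.
pose B := (\sum_t <<r t>>)%MS.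
have [/sub_sumsmxP [u ->]|] := boolP (a <= B)%MS.
  have /choice [f fP] t : exists c : K, u t *m <<r t>>%MS = c *: r t.
    by apply/sub_rVP; rewrite -(genmxE (r t)) submxMl.
  by left; exists f; apply: eq_bigr => t _; rewrite fP.
rewrite submxE => nz; right.
have [j nzj] : exists j, col j (a *m cokermx B) != 0.
  apply/existsP; apply: contraNT nz; rewrite negb_exists => /forallP z.
  apply/eqP/matrixP => i j; have /negPn /eqP /matrixP /(_ i 0) := z j.
  by rewrite !mxE.
exists (col j (cokermx B)); split=> [t|]; last by rewrite colE mulmxA -colE; apply/eqP.
rewrite colE mulmxA.
have : (r t <= B)%MS by rewrite -(genmxE (r t)) (sumsmx_sup t).
by rewrite submxE => /eqP ->; rewrite mul0mx.
Qed.

Definition spans (K : fieldType) (V : lmodType K) (U : set V) (T : finType) (b : T -> V) :=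
  (forall i, U (b i)) /\ forall a, U a -> exists c : T -> K, a = \sum_i c i *: b i.

Lemma spans_ord (K : fieldType) (V : lmodType K) (U : set V) (T : finType) (b : T -> V) :
  spans U b -> exists N (c : 'I_N -> V), spans U c.
Proof.
move=> [Ub bU]; exists #|T|, (b \o enum_val); split=> [i|a /bU [c ->]]; first exact: Ub.
exists (c \o enum_val); by rewrite (reindex _ (onW_bij _ (enum_val_bij T))).
Qed.

(** A spanning family with the least number of members is free. *)
Lemma spans_basis (K : fieldType) (V : lmodType K) (U : set V) (T : finType) (b : T -> V) :
  spans U b -> exists N (c : 'I_N -> V), spans U c /\
    forall f : 'I_N -> K, \sum_i f i *: c i = 0 -> forall i, f i = 0.
Proof.
move=> /spans_ord exN.
have [|N /asboolP [c [Uc cU]] minN] := @ex_minnP (fun N => `[< exists c : 'I_N -> V, spans U c >]).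
  by have [N hN] := exN; exists N; apply/asboolP.
exists N, c; split=> // f f0 i; apply/eqP; apply: contraT => fi0.
case: N => [|N] in c Uc cU minN f f0 i fi0 *; first by case: i {fi0}.
suff : (N.+1 <= N)%N by rewrite ltnn.
apply: minN; apply/asboolP; exists (c \o lift i); split=> [j|a /cU [e ->]]; first exact: Uc.
have ci : c i = - \sum_j (f (lift i j) / f i) *: c (lift i j).
  move: f0; rewrite (bigD1_ord i) //= => /eqP; rewrite addr_eq0 => /eqP f0.
  rewrite -[c i]scale1r -(mulVf fi0) -scalerA f0 scalerN scaler_sumr; congr (- _).
  by apply: eq_bigr => j _; rewrite scalerA mulrC.
exists (fun j => e (lift i j) - e i * (f (lift i j) / f i)).
rewrite (bigD1_ord i) //= ci scalerN scaler_sumr addrC -sumrB.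
by apply: eq_bigr => j _; rewrite scalerBl scalerA.
Qed.

Lemma ratfun_common_denominator (k : fieldType) n (T : finType) (w : T -> ratfun k n) :
  exists (D : {mpoly k[n]}) (w' : T -> {mpoly k[n]}), D != 0 /\
    forall s, ratfun_poly D * w s = ratfun_poly (w' s).
Proof.
have frac1 (f : ratfun k n) : exists pq : {mpoly k[n]} * {mpoly k[n]}, pq.2 != 0 /\
    ratfun_poly pq.2 * f = ratfun_poly pq.1.
  exists (frac (repr f)); split; first exact: denom_ratioP.
  have := reprK (f : {fraction {mpoly k[n]}}); set r := repr _ => def_f.
  apply/eqP; rewrite -{}def_f /ratfun_poly.
  rewrite /GRing.mul /= !piE /FracField.equivf /FracField.mulf.
  by rewrite !numden_Ratio ?mulf_neq0 ?oner_eq0 ?denom_ratioP //; rewrite mul1r mulr1 mulrC.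
have /choice [pq pqP] s := frac1 (w s).
exists (\prod_s (pq s).2), (fun s => (\prod_(t | t != s) (pq t).2) * (pq s).1); split.
  by apply/prodf_neq0 => s _; case: (pqP s).
move=> s; rewrite (bigD1 s) //= /ratfun_poly !tofracM.
by rewrite -[tofrac (pq s).1](proj2 (pqP s)) /ratfun_poly mulrA; congr (_ * _); rewrite mulrC.
Qed.

End LinearAlgebra.

(** * Specialization of the generic linear forms *)

Section PureTensors.
Variables (k : comNzRingType) (A B : comAlgType k).
Local Notation pure := (@tensor_pure k A B).

Lemma tensor_pureDl a a' b : pure (a + a') b = pure a b + pure a' b.
Proof. by rewrite [RHS]tensor_addE; apply/tensor_pi/tensor_addl. Qed.

Lemma tensor_pureDr a b b' : pure a (b + b') = pure a b + pure a b'.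
Proof. by rewrite [RHS]tensor_addE; apply/tensor_pi/tensor_addr. Qed.

Lemma tensor_pure0l b : pure 0 b = 0.
Proof. exact/tensor_pi/tensor_zero. Qed.

Lemma tensor_pureZ c a b : pure (c *: a) b = pure a (c *: b).
Proof. exact/tensor_pi/tensor_scale. Qed.

Lemma tensor_pure0r a : pure a 0 = 0.
Proof. by rewrite -(scale0r 0) -tensor_pureZ scale0r tensor_pure0l. Qed.

Lemma tensor_pureM a a' b b' : pure a b * pure a' b' = pure (a * a') (b * b').
Proof. by rewrite [LHS]tensor_mulE. Qed.

Lemma tensor_pure_suml (I : Type) (s : seq I) (F : I -> A) b :
  pure (\sum_(i <- s) F i) b = \sum_(i <- s) pure (F i) b.
Proof. by apply: (big_morph (pure^~ b)) => [a a'|]; rewrite ?tensor_pureDl ?tensor_pure0l. Qed.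

Lemma tensor_pure_sumr (I : Type) (s : seq I) a (F : I -> B) :
  pure a (\sum_(i <- s) F i) = \sum_(i <- s) pure a (F i).
Proof. by apply: (big_morph (pure a)) => [b b'|]; rewrite ?tensor_pureDr ?tensor_pure0r. Qed.

End PureTensors.

Lemma smallest_ideal_ideal (R : comPzRingType) (L : set R) : ideal (smallest ideal L).
Proof.
split=> [I [[]]//|a b sa sb I hI|c a sa I hI]; have [[I0 ID IM] _] := hI.
  by apply: ID; [apply: sa | apply: sb].
by apply: IM; apply: sa.
Qed.

Section Specialization.
Variables (k : closedFieldType) (A : comAlgType k) (A_ : nat -> set A).
Hypothesis hA : standard_graded A_.
Variables (d m : nat) (x : 'I_m -> A).
Hypothesis hx : A_ 1%N = range (fun c : 'I_m -> k => \sum_(j < m) c j *: x j).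

Lemma mpoly_to_generic_form (i : 'I_d) :
  mpoly_to_generic (generic_form x i) =
    \sum_j tensor_pure (x j) (ratfun_poly 'X_(mxvec_index i j)).
Proof.
have coefE e : (generic_form x i)@_e = \sum_j x j *+ (U_(mxvec_index i j)%MM == e).
  rewrite raddf_sum; apply: eq_bigr => j _ /=.
  by rewrite mcoeffCM mcoeffX mulr_natr.
pose s := [seq U_(l)%MM | l : 'I_(d * m)].
have uniq_s : uniq s.
  by rewrite map_inj_uniq ?enum_uniq // => l l' /eqP; rewrite eq_mnm1 => /eqP.
have supp_s : {subset msupp (generic_form x i) <= s}.
  move=> e; rewrite mcoeff_msupp coefE => nz.
  apply: contraNT nz => nse; apply/eqP/big1 => j _.
  by case: eqP nse => // <-; rewrite map_f ?mem_enum.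
pose G e : generic_algebra A d m :=
  tensor_pure (generic_form x i)@_e (ratfun_poly 'X_[e]).
transitivity (\sum_(e <- s) G e).
  rewrite (bigID (mem (msupp (generic_form x i)))) /= [X in _ + X]big1 ?addr0 => [|e].
    rewrite -big_filter; apply: perm_big; apply: uniq_perm.
    - exact: msupp_uniq.
    - exact: filter_uniq.
    - by move=> e; rewrite mem_filter; case: (boolP (e \in msupp _)) => // /supp_s ->.
  by move=> /memN_msupp_eq0 e0; rewrite /G e0 tensor_pure0l.
rewrite big_map big_enum /=.
transitivity (\sum_l \sum_j (tensor_pure
    (x j *+ (U_(mxvec_index i j)%MM == U_(l)%MM :> 'X_{1..d * m}))
    (ratfun_poly 'X_l) : generic_algebra A d m)).
  by apply: eq_bigr => l _; rewrite /G coefE tensor_pure_suml.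
rewrite exchange_big; apply: eq_bigr => j _ /=.
rewrite (bigD1 (mxvec_index i j)) //= eqxx mulr1n big1 ?addr0 // => l.
by rewrite eq_mnm1 eq_sym => /negPf ->; rewrite mulr0n tensor_pure0l.
Qed.

Definition special_form (v : 'I_(d * m) -> k) (i : 'I_d) : A :=
  \sum_(j < m) v (mxvec_index i j) *: x j.

Lemma special_form_degree1 v i : A_ 1%N (special_form v i).
Proof. by rewrite hx; exists (fun j => v (mxvec_index i j)). Qed.

Lemma degree1_special_form (z : 'I_d -> A) : (forall i, A_ 1%N (z i)) ->
  exists v, z = special_form v.
Proof.
move=> z1; have /choice [C CP] i : exists c : 'I_m -> k, z i = \sum_j c j *: x j.
  by have := z1 i; rewrite hx => -[c _ <-]; exists c.
exists (fun l => mxvec (\matrix_(i, j) C i j) 0 l); apply/funext => i.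
by rewrite CP; apply: eq_bigr => j _; rewrite mxvecE mxE.
Qed.

Lemma graded_spans n : exists N (c : 'I_N -> A), spans (A_ n) c.
Proof.
elim: n => [|n [N [c [Ac cA]]]].
  exists 1%N, (fun=> 1); split=> [_|a].
    by rewrite -(scale1r 1); apply: (graded_scalar hA).
  rewrite (standard_degree0 hA) => -[e _ <-]; exists (fun=> e).
  by rewrite big_ord1.
apply: (@spans_ord _ _ _ ('I_m * 'I_N)%type (fun t => c t.2 * x t.1)); split=> [t|a].
  rewrite -addn1; apply: (graded_mul (standard_graded_algebra hA)) (Ac _) _.
  exact: degree1_gen hx _.
move=> /(gradedS hA hx) [w [Aw ->]].
have /choice [e eP] j : exists e : 'I_N -> k, w j = \sum_i e i *: c i := cA _ (Aw j).
exists (fun t => e t.1 t.2); rewrite -(pair_bigA _ (fun j i => e j i *: (c i * x j))) /=.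
apply: eq_bigr => j _; rewrite {1}eP mulr_suml.
by apply: eq_bigr => i _; rewrite scalerAl.
Qed.

Section Level.
Variables (n p N : nat) (b : 'I_p -> A) (c : 'I_N -> A).
Hypotheses (b_spans : spans (A_ n) b) (c_spans : spans (A_ n.+1) c).
Hypothesis c_free : forall f : 'I_N -> k, \sum_i f i *: c i = 0 -> forall i, f i = 0.
Variable mu : 'I_m -> 'I_p -> 'I_N -> k.
Hypothesis muP : forall j r, b r * x j = \sum_s mu j r s *: c s.

(** The coordinates of [b r * z_i], where [z_i] is the [i]-th generic form and
    [t = (i, r)], in the basis [c] extended to polynomial coefficients. *)
Definition generic_row (t : 'I_d * 'I_p) (s : 'I_N) : {mpoly k[d * m]} :=
  \sum_j mu j t.2 s *: 'X_(mxvec_index t.1 j).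

Lemma generic_row_eval v t : \sum_s (generic_row t s).@[v] *: c s = b t.2 * special_form v t.1.
Proof.
rewrite /special_form mulr_sumr.
rewrite (eq_bigr (fun s => \sum_j v (mxvec_index t.1 j) *: (mu j t.2 s *: c s))).
  rewrite exchange_big; apply: eq_bigr => j _.
  by rewrite -scalerAr muP scaler_sumr.
move=> s _; rewrite raddf_sum scaler_suml; apply: eq_bigr => j _ /=.
by rewrite mevalZ mevalXU scalerA mulrC.
Qed.

Lemma special_form_membership v (alpha : 'I_N -> k) :
  family_ideal (special_form v) (\sum_s alpha s *: c s) <->
  exists g : 'I_d * 'I_p -> k, forall s, alpha s = \sum_t g t * (generic_row t s).@[v].
Proof.
have expand (g : 'I_d * 'I_p -> k) :
    \sum_s (\sum_t g t * (generic_row t s).@[v]) *: c s =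
    \sum_t g t *: (b t.2 * special_form v t.1).
  under eq_bigr do rewrite scaler_suml; rewrite exchange_big; apply: eq_bigr => t _.
  by rewrite -generic_row_eval scaler_sumr; apply: eq_bigr => s _; rewrite scalerA.
split=> [|[g gP]]; last first.
  have -> : \sum_s alpha s *: c s = \sum_t g t *: (b t.2 * special_form v t.1).
    by rewrite -expand; apply: eq_bigr => s _; rewrite gP.
  apply: ideal_sum => [|t]; first exact: family_ideal_ideal.
  rewrite scalerAl; have [_ _ IM] := family_ideal_ideal (special_form v).
  exact/IM/family_ideal_gen.
have Aa : A_ n.+1 (\sum_s alpha s *: c s).
  apply: (graded_bigsum hA) => s; apply: (gradedZ hA).
  by case: c_spans.
move=> /(family_ideal_homog hA (special_form_degree1 v) Aa) [g [Ag ag]].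
have /choice [e eP] i : exists e : 'I_p -> k, g i = \sum_r e r *: b r.
  by case: b_spans => _; apply.
exists (fun t => e t.1 t.2) => s; apply/eqP; rewrite -subr_eq0; apply/eqP.
move: s; apply: c_free.
under eq_bigr do rewrite scalerBl; rewrite sumrB expand ag.
rewrite -(pair_bigA _ (fun i r => e i r *: (b r * special_form v i))) /=; apply/eqP.
rewrite subr_eq0; apply/eqP/eq_bigr => i _; rewrite {1}eP mulr_suml.
by apply: eq_bigr => r _; rewrite scalerAl.
Qed.

(** The matrix [G] expresses the basis [c] through the elements [b r * z_i(v0)],
    so the product [H] of [G] with the matrix of generic rows specializes to the
    identity at [v0]. Wherever [\det H] does not vanish, the specialized rows
    still span. *)
Lemma full_degree_open v0 : A_ n.+1 `<=` family_ideal (special_form v0) ->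
  exists F : {mpoly k[d * m]}, F.@[v0] != 0 /\
    forall v, F.@[v] != 0 -> A_ n.+1 `<=` family_ideal (special_form v).
Proof.
move=> full; have [Ac cA] := c_spans.
have /choice [G GP] s : exists g : 'I_d * 'I_p -> k,
    forall s', (s' == s)%:R = \sum_t g t * (generic_row t s').@[v0].
  apply/special_form_membership; apply: full; apply: (graded_bigsum hA) => s'.
  exact: (gradedZ hA).
pose H : 'M[{mpoly k[d * m]}]_N := \matrix_(s, s') \sum_t G s t *: generic_row t s'.
have evalH v s s' : (map_mx (meval v) H) s s' = \sum_t G s t * (generic_row t s').@[v].
  by rewrite !mxE raddf_sum; apply: eq_bigr => t _; rewrite /= mevalZ.
exists (\det H); split=> [|v].
  rewrite -det_map_mx (_ : map_mx _ _ = 1%:M) ?det1 ?oner_eq0 //.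
  by apply/matrixP => s s'; rewrite evalH -GP mxE eq_sym.
rewrite -det_map_mx -unitfE => unitH a /cA [alpha ->].
apply/special_form_membership.
pose beta := (\row_s alpha s) *m invmx (map_mx (meval v) H).
exists (fun t => \sum_s beta 0 s * G s t) => s.
have -> : alpha s = (beta *m map_mx (meval v) H) 0 s by rewrite mulmxKV // mxE.
rewrite mxE; under [RHS]eq_bigr do rewrite mulr_suml; rewrite exchange_big.
apply: eq_bigr => s' _; rewrite evalH mulr_sumr; apply: eq_bigr => t _.
by rewrite mulrA.
Qed.

(** Either the coordinates [alpha] are a combination of the generic rows over
    [k(u)], or a column that annihilates these rows but not [alpha] exists; with
    denominators cleared it rules out a solution at every point where
    its pairing with [alpha] does not vanish. *)
Lemma generic_solution_or_witness (alpha : 'I_N -> k) :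
  (exists f : 'I_d * 'I_p -> ratfun k (d * m), forall s,
     ratfun_poly (alpha s)%:MP = \sum_t f t * ratfun_poly (generic_row t s)) \/
  (exists P : {mpoly k[d * m]}, P != 0 /\
     forall v, P.@[v] != 0 -> ~ family_ideal (special_form v) (\sum_s alpha s *: c s)).
Proof.
pose row_of (r : 'I_N -> {mpoly k[d * m]}) : 'rV[ratfun k (d * m)]_N :=
  \row_s ratfun_poly (r s).
have [[f fP]|[w [w0 wa]]] := row_span_or_dual (fun t => row_of (generic_row t))
  (row_of (fun s => (alpha s)%:MP)).
  left; exists f => s; have := congr1 (fun r : 'rV__ => r 0 s) fP.
  by rewrite mxE summxE => ->; apply: eq_bigr => t _; rewrite !mxE.
right; have [D [w' [D0 w'P]]] := ratfun_common_denominator (fun s => w s 0).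
have pairing r : ratfun_poly D * (row_of r *m w) 0 0 = ratfun_poly (\sum_s r s * w' s).
  rewrite mxE mulr_sumr /ratfun_poly rmorph_sum; apply: eq_bigr => s _.
  by rewrite mxE mulrCA w'P /= tofracM.
have rows0 t : \sum_s generic_row t s * w' s = 0.
  by apply/eqP; rewrite -tofrac_eq0 -[tofrac _]pairing w0 mxE mulr0.
exists (\sum_s (alpha s)%:MP * w' s); split.
  rewrite -tofrac_eq0 -[tofrac _]pairing mulf_neq0 //; first by rewrite tofrac_eq0.
  by apply: contra_notN wa => /eqP e; apply/matrixP => i j; rewrite !ord1 e mxE.
move=> v /eqP nz /special_form_membership [g gP]; apply: nz.
have -> : (\sum_s (alpha s)%:MP * w' s).@[v] =
    \sum_t g t * (\sum_s generic_row t s * w' s).@[v].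
  rewrite raddf_sum; under [RHS]eq_bigr do rewrite raddf_sum mulr_sumr.
  rewrite exchange_big; apply: eq_bigr => s _ /=.
  rewrite mevalM mevalC gP mulr_suml; apply: eq_bigr => t _.
  by rewrite mevalM mulrA.
by rewrite big1 // => t _; rewrite rows0 meval0 mulr0.
Qed.

Lemma generic_solution_extended (alpha : 'I_N -> k) (f : 'I_d * 'I_p -> ratfun k (d * m)) :
  (forall s, ratfun_poly (alpha s)%:MP = \sum_t f t * ratfun_poly (generic_row t s)) ->
  extended_generic_ideal x (@to_generic k A d m (\sum_s alpha s *: c s)).
Proof.
move=> fP.
have -> : to_generic d m (\sum_s alpha s *: c s) =
    \sum_t tensor_pure (b t.2) (f t) * mpoly_to_generic (generic_form x t.1).
  pose X (t : 'I_d * 'I_p) j : ratfun k (d * m) := ratfun_poly 'X_(mxvec_index t.1 j).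
  rewrite /to_generic tensor_pure_suml.
  transitivity (\sum_s \sum_(t : 'I_d * 'I_p) \sum_j
      tensor_pure (mu j t.2 s *: c s) (f t * X t j)).
    apply: eq_bigr => s _; rewrite tensor_pureZ.
    have -> : alpha s *: (1 : ratfun k (d * m)) =
        \sum_t \sum_j mu j t.2 s *: (f t * X t j).
      rewrite [LHS]mulr1 [LHS]fP; apply: eq_bigr => t _.
      rewrite /generic_row /ratfun_poly rmorph_sum mulr_sumr; apply: eq_bigr => j _.
      by rewrite /= -mul_mpolyC tofracM mulrCA.
    rewrite tensor_pure_sumr; apply: eq_bigr => t _; rewrite tensor_pure_sumr.
    by apply: eq_bigr => j _; rewrite tensor_pureZ.
  rewrite exchange_big; apply: eq_bigr => t _; rewrite mpoly_to_generic_form mulr_sumr.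
  rewrite exchange_big; apply: eq_bigr => j _.
  by rewrite -tensor_pure_suml -muP [RHS]tensor_pureM.
have [_ ID IM] := smallest_ideal_ideal (@mpoly_to_generic k A d m @` generic_ideal x).
have [I0 _ _] := smallest_ideal_ideal (@mpoly_to_generic k A d m @` generic_ideal x).
apply: big_ind => // t _; apply: IM => I [_]; apply; exists (generic_form x t.1) => //.
by move=> J [_]; apply; exists t.1.
Qed.

End Level.

Lemma degree_bases n : exists p N (b : 'I_p -> A) (c : 'I_N -> A)
    (mu : 'I_m -> 'I_p -> 'I_N -> k),
  [/\ spans (A_ n) b, spans (A_ n.+1) c,
      forall f : 'I_N -> k, \sum_i f i *: c i = 0 -> forall i, f i = 0
    & forall j r, b r * x j = \sum_s mu j r s *: c s].
Proof.
have [p [b bS]] := graded_spans n; have [N0 [c0 c0S]] := graded_spans n.+1.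
have [N [c [cS c_free]]] := spans_basis c0S.
have /choice [mu muP] (jr : 'I_m * 'I_p) :
    exists e : 'I_N -> k, b jr.2 * x jr.1 = \sum_s e s *: c s.
  case: cS => _; apply; rewrite -addn1.
  apply: (graded_mul (standard_graded_algebra hA)); first by case: bS.
  exact: degree1_gen hx _.
by exists p, N, b, c, (fun j r => mu (j, r)); split=> // j r; apply: (muP (j, r)).
Qed.

Lemma special_form_reduction v n : A_ n `<=` family_ideal (special_form v) ->
  reduction A_ (family_ideal (special_form v)).
Proof.
move=> full; split.
- by apply: (family_ideal_graded hA); apply: special_form_degree1.
- exists (range (special_form v)); last by rewrite smallest_ideal_range.
  by move=> _ [i _ <-]; apply: special_form_degree1.
exists n => j lenj; apply/setIidPr; rewrite -(subnK lenj).
exact: (graded_sub_ideal hA hx (family_ideal_ideal _) full).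
Qed.

Lemma generic_reductions : krull_dim_eq A d ->
  exists F : {mpoly k[d * m]}, F != 0 /\
    forall v, F.@[v] != 0 -> reduction A_ (family_ideal (special_form v)).
Proof.
move=> hdim; have [z [n [z1 full]]] := exists_linear_parameters hA hx hdim.
have [v0 def_z] := degree1_special_form z1; rewrite def_z in full.
have fullS := graded_sub_ideal hA hx (j := 1) (family_ideal_ideal _) full.
have [p [N [b [c [mu [bS cS cF muP]]]]]] := degree_bases n.
have [F [F0 fullF]] := full_degree_open bS cS cF muP fullS.
exists F; split=> [|v /fullF]; last exact: special_form_reduction.
by apply: contraNneq F0 => ->; rewrite meval0.
Qed.

(** In degree 0 the claim is that the core vanishes, because [Q_v] is generated in
    degree 1; in higher degree a point [v] where neither the polynomial of
    [generic_reductions] nor that of [generic_solution_or_witness] vanishes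
    excludes the second alternative of the latter. *)
Lemma core_extended_homog a n : krull_dim_eq A d -> core A_ a -> A_ n a ->
  extended_generic_ideal x (@to_generic k A d m a).
Proof.
move=> /generic_reductions [F [F0 redF]] core_a.
case: n => [|n] Aa.
  have [v Fv] := mpoly_nonvanishing F0.
  rewrite (family_ideal_degree0 hA (special_form_degree1 v) Aa (core_a _ (redF v Fv))).
  rewrite /to_generic tensor_pure0l.
  by have [] := smallest_ideal_ideal (@mpoly_to_generic k A d m @` generic_ideal x).
have [p [N [b [c [mu [bS cS cF muP]]]]]] := degree_bases n.
have [alpha def_a] := proj2 cS a Aa.
have [[f fP]|[P [P0 Pout]]] := generic_solution_or_witness bS cS cF muP alpha.
  by rewrite def_a; exact: (generic_solution_extended muP fP).
have [v] := mpoly_nonvanishing (mulf_neq0 F0 P0).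
rewrite mevalM mulf_eq0 negb_or => /andP[Fv Pv].
by case: (Pout v Pv); rewrite -def_a; exact: core_a _ (redF v Fv).
Qed.

End Specialization.

Theorem corollary1p12 (k : closedFieldType) (A : comAlgType k)
    (A_ : nat -> set A) (hA : standard_graded A_)
    (d : nat) (hdim : krull_dim_eq A d) (hd : (1 <= d)%N)
    (m : nat) (x : 'I_m -> A)
    (hx : A_ 1%N = range (fun c : 'I_m -> k => \sum_(j < m) c j *: x j)) :
  core A_ `<=` @to_generic k A d m @^-1` extended_generic_ideal x.
Proof.
move=> a core_a /=; have [N [c [Ac def_a]]] := graded_sum (standard_graded_algebra hA) a.
rewrite def_a /to_generic tensor_pure_suml.
have [I0 ID _] := smallest_ideal_ideal (@mpoly_to_generic k A d m @` generic_ideal x).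
apply: big_ind => // i _; apply: (core_extended_homog hA hx hdim) (Ac i).
move=> Q redQ; have [[_ gradQ] _ _] := redQ.
by apply: (gradQ N) => //; rewrite -def_a; apply: core_a.
Qed.
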